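(* Let $(X,d)$ be a complete metric space and $\phi:X\to(-\infty,\infty]$ a lower semi-continuous function with $D(\phi)\neq\emptyset$ such that, with respect to a family $\Gamma$ of minimal geodesics and for some $\lambda,K\in\mathbb{R}$, $\phi$ is $\lambda$-convex, the squared distance function is $K$-convex, the commutativity holds, and $\phi$ is coercive (conditions (a)-(d) of the context). Let $\mathcal{G}$ be the gradient flow operator of $\phi$ and $|\nabla\phi|$ its local slope. Take $x_0\in D(\phi)$, put $\xi(t):=\mathcal{G}(t,x_0)$ and assume $\lim_{t\to\infty}\phi(\xi(t))>-\infty$. Then $\lim_{t\to\infty}|\nabla\phi|(\xi(t))=0$.
   Context: Setting. A minimal geodesic is a curve $\gamma:[0,1]\to X$ with $d(\gamma(s),\gamma(t))=|s-t|\,d(\gamma(0),\gamma(1))$ for all $s,t\in[0,1]$. $D(\phi):=X\setminus\phi^{-1}(\infty)$. $\lambda$ and $K$ may be negative. $\Gamma$ is a family of minimal geodesics in $X$ containing, for every $x,y\in X$, at least one minimal geodesic from $x$ to $y$, such that: (a) ($\lambda$-convexity of $\phi$) for every $\gamma\in\Gamma$ with $\gamma(0),\gamma(1)\in D(\phi)$ and every $t\in[0,1]$, $\phi(\gamma(t))\le(1-t)\phi(\gamma(0))+t\phi(\gamma(1))-\frac{\lambda}{2}(1-t)t\,d^2(\gamma(0),\gamma(1))$; (b) ($K$-convexity of the squared distance) for every $z\in X$, $\gamma\in\Gamma$, $t\in[0,1]$, $d^2(z,\gamma(t))\le(1-t)d^2(z,\gamma(0))+t\,d^2(z,\gamma(1))-\frac{K}{2}(1-t)t\,d^2(\gamma(0),\gamma(1))$;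 (c) (commutativity) for all $\gamma,\eta\in\Gamma$ with $\gamma(0)=\eta(0)=x$, $\gamma(1)=y$, $\eta(1)=z$, the following limits exist and agree: $\lim_{s\downarrow 0}\frac{d^2(\gamma(s),z)-d^2(x,z)}{s}=\lim_{t\downarrow 0}\frac{d^2(\eta(t),y)-d^2(x,y)}{t}$; (d) (coercivity) there is $\tau_*(\phi)\in(0,\infty]$ such that for all $x\in X$ and $\tau\in(0,\tau_*(\phi))$, $\phi_\tau(x):=\inf_{z\in X}\{\phi(z)+\frac{d^2(x,z)}{2\tau}\}>-\infty$ and $J^\phi_\tau(x):=\{z\in X: \phi(z)+\frac{d^2(x,z)}{2\tau}=\phi_\tau(x)\}\neq\emptyset$. This setting includes the case where $(X,d)$ is a complete $\mathrm{CAT}(1)$-space with $\operatorname{diam}X<\pi/2$ and $\phi$ is lower semi-continuous and $\lambda$-convex along minimal geodesics ($\Gamma$ being all minimal geodesics; then (b) for some $K>0$, (c) and (d) hold). Discrete solutions. A partition is $\mathscr{P}_{\boldsymbol{\tau}}=\{0=t^0_{\boldsymbol{\tau}}<t^1_{\boldsymbol{\tau}}<\cdots\}$ with $t^k_{\boldsymbol{\tau}}\to\infty$; $\tau_k:=t^k_{\boldsymbol{\tau}}-t^{k-1}_{\boldsymbol{\tau}}$, $|\boldsymbol{\tau}|:=\sup_{k\ge1}\tau_k$ (always assumed $<\tau_*(\phi)$). A discrete solution from $x_0\in D(\phi)$ associated with $\mathscr{P}_{\boldsymbol{\tau}}$ is a sequence with $x^0_{\boldsymbol{\tau}}=x_0$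 and $x^k_{\boldsymbol{\tau}}\in J^\phi_{\tau_k}(x^{k-1}_{\boldsymbol{\tau}})$ for $k\ge1$. Its interpolated curve is $\bar{x}_{\boldsymbol{\tau}}(0):=x_0$, $\bar{x}_{\boldsymbol{\tau}}(t):=x^k_{\boldsymbol{\tau}}$ for $t\in(t^{k-1}_{\boldsymbol{\tau}},t^k_{\boldsymbol{\tau}}]$. Gradient flow. In this setting, for each $x_0\in D(\phi)$ the interpolated curves $\bar{x}_{\boldsymbol{\tau}}$ converge, as $|\boldsymbol{\tau}|\to0$, uniformly on bounded intervals to a curve $\xi:[0,\infty)\to D(\phi)$ with $\xi(0)=x_0$ which is independent of the choices of partitions and discrete solutions; one defines $\mathcal{G}:[0,\infty)\times D(\phi)\to D(\phi)$ by $\mathcal{G}(t,x_0):=\xi(t)$. The function $t\mapsto\phi(\xi(t))$ is non-increasing. Local slope. For $x\in D(\phi)$, $|\nabla\phi|(x):=\limsup_{y\to x}\frac{\max\{\phi(x)-\phi(y),0\}}{d(x,y)}$. *)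

(* Defs.v *)
From HB Require Import structures.
From mathcomp Require Import all_boot all_order all_algebra.
From mathcomp Require Import all_classical all_reals all_analysis.
Set Implicit Arguments.
Unset Strict Implicit.
Unset Printing Implicit Defensive.
Import Order.TTheory GRing.Theory Num.Theory.
Import numFieldNormedType.Exports.
Local Open Scope classical_set_scope.
Local Open Scope ring_scope.

(* Pointedness is part of the library's [Complete]; it only says that the
   space is nonempty. *)
#[short(type="completeMetricType")]
HB.structure Definition CompleteMetric (R : numDomainType) :=
  {T of Complete T & Metric R T}.

Section GradientFlow.
Context {R : realType} {X : metricType R}.
Implicit Types (phi : X -> \bar R) (Gamma : set (R -> X)) (x y z : X).

Definition finite_domain phi : set X := [set x | phi x != +oo%E].

(* Curves [0,1] -> X are represented by functions R -> X; no definition below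
   uses their values outside [0,1]. *)
Definition minimal_geodesic (g : R -> X) : Prop :=
  forall s t : R, 0 <= s <= 1 -> 0 <= t <= 1 ->
    mdist (g s) (g t) = `|s - t| * mdist (g 0) (g 1).

Definition geodesic_family Gamma : Prop :=
  Gamma `<=` minimal_geodesic /\
  forall x y, exists2 g, Gamma g & g 0 = x /\ g 1 = y.

Definition convex_along Gamma (lambda : R) phi : Prop :=
  forall g, Gamma g -> finite_domain phi (g 0) -> finite_domain phi (g 1) ->
  forall t : R, 0 <= t <= 1 ->
    (phi (g t) <= (1 - t)%:E * phi (g 0%R) + t%:E * phi (g 1%R)
       - (lambda / 2 * (1 - t) * t * mdist (g 0) (g 1) ^+ 2)%R%:E)%E.

Definition sqdist_convex_along Gamma (K : R) : Prop :=
  forall z g, Gamma g -> forall t : R, 0 <= t <= 1 ->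
    mdist z (g t) ^+ 2 <=
      (1 - t) * mdist z (g 0) ^+ 2 + t * mdist z (g 1) ^+ 2
      - K / 2 * (1 - t) * t * mdist (g 0) (g 1) ^+ 2.

Definition commutativity Gamma : Prop :=
  forall g h, Gamma g -> Gamma h -> g 0 = h 0 ->
  exists l : R,
    (mdist (g s) (h 1) ^+ 2 - mdist (g 0) (h 1) ^+ 2) / s @[s --> 0^'+] --> l /\
    (mdist (h t) (g 1) ^+ 2 - mdist (h 0) (g 1) ^+ 2) / t @[t --> 0^'+] --> l.

Definition resolvent_functional phi (tau : R) x z : \bar R :=
  (phi z + (mdist x z ^+ 2 / (2 * tau))%R%:E)%E.

Definition moreau_yosida phi (tau : R) x : \bar R :=
  ereal_inf [set resolvent_functional phi tau x z | z in [set: X]].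

Definition resolvent phi (tau : R) x : set X :=
  [set z | resolvent_functional phi tau x z = moreau_yosida phi tau x].

Definition coercive phi (taustar : \bar R) : Prop :=
  (0 < taustar)%E /\
  forall x (tau : R), 0 < tau -> (tau%:E < taustar)%E ->
    (-oo < moreau_yosida phi tau x)%E /\ resolvent phi tau x !=set0.

Definition partition_of_halfline (P : nat -> R) : Prop :=
  [/\ P 0%N = 0, (forall k, P k < P k.+1) & P k @[k --> \oo] --> +oo].

Definition mesh (P : nat -> R) : \bar R :=
  ereal_sup [set (P k.+1 - P k)%:E | k in [set: nat]].

Definition discrete_solution phi (P : nat -> R) x0 (xs : nat -> X) : Prop :=
  xs 0%N = x0 /\ forall k, resolvent phi (P k.+1 - P k) (xs k) (xs k.+1).

(* For t > 0 the set below is the singleton of the index n with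
   P n.-1 < t <= P n; for t = 0 it is empty and the value is xs 0. *)
Definition interpolated_curve (P : nat -> R) (xs : nat -> X) (t : R) : X :=
  xs (xget 0%N [set n | exists2 k, n = k.+1 & P k < t <= P k.+1]).

Definition discrete_limit phi (taustar : \bar R) x0 (xi : R -> X) : Prop :=
  forall T eps : R, 0 < eps ->
  exists2 delta : R, 0 < delta &
    forall P xs, partition_of_halfline P ->
      (mesh P < taustar)%E -> (mesh P < delta%:E)%E ->
      discrete_solution phi P x0 xs ->
      forall t : R, 0 <= t <= T ->
        mdist (interpolated_curve P xs t) (xi t) < eps.

(* [G] represents a map [0,oo) x D(phi) -> D(phi); its values elsewhere are
   irrelevant. The condition determines it there, since discrete solutions of
   arbitrarily small mesh exist when [phi] is coercive. *)
Definition gradient_flow_operator phi (taustar : \bar R) (G : R -> X -> X) :=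
  forall x0, finite_domain phi x0 ->
    (forall t : R, 0 <= t -> finite_domain phi (G t x0)) /\
    discrete_limit phi taustar x0 (G ^~ x0).

(* The difference quotient is nonnegative, so the outer maximum only matters
   at an isolated point, where the limsup is over an empty punctured
   neighbourhood (hence -oo) and the slope is 0 by convention. *)
Definition local_slope phi x : \bar R :=
  maxe 0%E (limf_esup
    (fun y => maxe (phi x - phi y) 0 * ((mdist x y)^-1)%R%:E)%E x^').

End GradientFlow.

(* Main.v *)
Require Import Defs.
From mathcomp Require Import all_boot all_order all_algebra.
From mathcomp Require Import all_classical all_reals all_analysis.
From mathcomp Require Import ring lra.
Import Order.TTheory GRing.Theory Num.Theory.
Import numFieldNormedType.Exports.
Local Open Scope classical_set_scope.
Local Open Scope ring_scope.

(* Along a minimizing movement scheme with constant step tau, lambda-convexity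
   bounds the slope at x_(k+1) by the speed v_k := d(x_k, x_(k+1)) / tau and
   makes the speeds almost decreasing: (1 - L tau) v_(k+1) <= v_k whenever phi
   is (-L)-convex.  Since each step dissipates at least tau v_k^2 / 2, the last
   speed on a time window of length h <= 1/(2L) satisfies
   v^2 <= (8/h) (drop of phi over the window).  As tau -> 0, lower
   semicontinuity of phi and the slope bound itself, used as an upper bound for
   phi along the scheme, turn this into
   |grad phi|^2 (xi (t + h)) <= (8/h) (phi (xi t) - phi (xi (t + h))),
   whose right-hand side tends to 0. *)

(** * Elementary inequalities *)

(** Stands in for letting s tend to 0. The range stops at 1 so that s can serve as a geodesic
    parameter. *)
Lemma ler_lim0 (R : realFieldType) (u v c : R) :
  (forall s : R, 0 < s <= 1 -> u <= v + s * c) -> u <= v.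
Proof.
move=> uvc; apply/ler_addgt0Pl => e e0.
have c0 : 0 < `|c| + 1 by rewrite ltr_pwDr.
pose s := Num.min 1 (e / (`|c| + 1)).
have s0 : 0 < s by rewrite lt_min ltr01 divr_gt0.
have s1 : s <= 1 by rewrite ge_min lexx.
have se : s * (`|c| + 1) <= e by rewrite -ler_pdivlMr// ge_min lexx orbT.
have := uvc s; rewrite s0 s1 => /(_ isT) /le_trans; apply.
rewrite addrC lerD2r (le_trans _ se)// ler_wpM2l ?(ltW s0)//.
by rewrite (le_trans (ler_norm c))// lerDl.
Qed.

Lemma bernoulli_ge (R : realFieldType) (u : R) (n : nat) :
  0 <= u <= 1 -> 1 - n%:R * u <= (1 - u) ^+ n.
Proof.
move=> /andP[u0 u1]; elim: n => [|n IH]; first by rewrite expr0 mul0r subr0.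
rewrite exprS; apply: le_trans (_ : (1 - u) * (1 - n%:R * u) <= _).
  have : 0 <= n%:R * u * u by rewrite !mulr_ge0.
  by rewrite -natr1; nra.
by rewrite ler_wpM2l// subr_ge0.
Qed.

(** * One resolvent step of a (-L)-convex function *)

Section semiconvex.
Context {R : realType} {X : metricType R}.
Variables (phi : X -> \bar R) (Gamma : set (R -> X)) (L : R).
Hypothesis phi_gtNy : forall x, (-oo < phi x)%E.
Hypothesis Gamma_geodesics : geodesic_family Gamma.
Hypothesis L_ge0 : 0 <= L.
Hypothesis phi_convex : convex_along Gamma (- L) phi.

Local Notation dom := (finite_domain phi).
Local Notation f x := (fine (phi x)).

Lemma finite_domain_fineK x : dom x -> phi x = (f x)%:E.
Proof.
rewrite /finite_domain/= => xdom; rewrite fineK// fin_numE xdom andbT.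
by rewrite -ltNye.
Qed.

Lemma geodesic_semiconvex x y (s : R) : dom x -> dom y -> 0 <= s <= 1 ->
  exists z, [/\ dom z, mdist x z = s * mdist x y,
    mdist z y = (1 - s) * mdist x y &
    f z <= (1 - s) * f x + s * f y + L / 2 * (1 - s) * s * mdist x y ^+ 2].
Proof.
move=> xd yd s01; have [Gmin /(_ x y)[g Gg [g0 g1]]] := Gamma_geodesics.
have I0 : 0 <= (0 : R) <= 1 by rewrite lexx ler01.
have I1 : 0 <= (1 : R) <= 1 by rewrite lexx ler01.
have := phi_convex _ Gg; rewrite g0 g1 => /(_ xd yd s s01) le_phi.
rewrite (finite_domain_fineK _ xd) (finite_domain_fineK _ yd) in le_phi.
rewrite -2!EFinM -EFinD in le_phi.
have gd : dom (g s).
  rewrite /finite_domain/=; apply/negP => /eqP E.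
  by move: le_phi; rewrite E.
exists (g s); split => //.
- have := Gmin _ Gg 0 s I0 s01; rewrite g0 g1 sub0r normrN.
  by case/andP: s01 => s0 _; rewrite ger0_norm.
- have := Gmin _ Gg s 1 s01 I1; rewrite g0 g1 distrC.
  by case/andP: s01 => _ s1; rewrite ger0_norm// subr_ge0.
- move: le_phi; rewrite (finite_domain_fineK _ gd) lee_fin => /le_trans; apply.
  by lra.
Qed.

Lemma resolvent_le (tau : R) x x' z : resolvent phi tau x x' ->
  (phi x' + (mdist x x' ^+ 2 / (2 * tau))%:E <=
   phi z + (mdist x z ^+ 2 / (2 * tau))%:E)%E.
Proof.
rewrite /resolvent/= /resolvent_functional /moreau_yosida => ->.
by apply: ereal_inf_lbound; exists z.
Qed.

Lemma resolvent_dom (tau : R) x x' : dom x -> resolvent phi tau x x' -> dom x'.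
Proof.
move=> xd /(resolvent_le _ _ _ x); rewrite (finite_domain_fineK _ xd) -EFinD.
by move=> le_x; rewrite /finite_domain/=; apply/negP => /eqP E; rewrite E in le_x.
Qed.

Lemma resolvent_fine_le (tau : R) x x' z :
  dom x -> dom z -> resolvent phi tau x x' ->
  f x' + mdist x x' ^+ 2 / (2 * tau) <= f z + mdist x z ^+ 2 / (2 * tau).
Proof.
move=> xd zd rx; have xd' := resolvent_dom _ _ _ xd rx.
have := resolvent_le _ _ _ z rx.
by rewrite (finite_domain_fineK _ zd) (finite_domain_fineK _ xd') -!EFinD lee_fin.
Qed.

(** Test the minimality of [x'] with the point [z] at parameter s of a geodesic from [x'] to [y].
    The triangle inequality gives d(x, z) <= d(x, x') + s d(x', y), and the terms of first order in
    s are the claim. *)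
Lemma resolvent_slope (tau : R) x x' y : 0 < tau ->
  dom x -> dom y -> resolvent phi tau x x' ->
  f x' - f y <= mdist x x' / tau * mdist x' y + L / 2 * mdist x' y ^+ 2.
Proof.
move=> tau0 xd yd rx; have xd' := resolvent_dom _ _ _ xd rx.
set a := mdist x x'; set D := mdist x' y.
apply: (@ler_lim0 _ _ _ (D ^+ 2 / (2 * tau))) => s /andP[s0 s1].
have [|z [zd xz _ fz]] := geodesic_semiconvex x' y s xd' yd.
  by rewrite (ltW s0).
have := resolvent_fine_le _ _ _ _ xd zd rx.
have a0 : 0 <= a := mdist_ge0 _ _.
have D0 : 0 <= D := mdist_ge0 _ _.
have xzD : mdist x z ^+ 2 <= (a + s * D) ^+ 2.
  rewrite ler_sqr ?nnegrE ?mdist_ge0 ?addr_ge0 ?mulr_ge0 ?(ltW s0)//.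
  by rewrite -xz; exact: metric_triangle.
have : mdist x z ^+ 2 / (2 * tau) <= (a + s * D) ^+ 2 / (2 * tau).
  by rewrite ler_pM2r// invr_gt0 mulr_gt0.
rewrite -/a -/D in fz *; move=> h1 h2.
rewrite -(ler_pM2l s0).
have -> : s * (a / tau * D + L / 2 * D ^+ 2 + s * (D ^+ 2 / (2 * tau))) =
  (a + s * D) ^+ 2 / (2 * tau) - a ^+ 2 / (2 * tau) + s * (L / 2 * D ^+ 2).
  by field; rewrite gt_eqF.
(* Semiconvexity gives the factor (1 - s) s; this term is what is lost in bounding it by s. *)
have : 0 <= s * s * (L / 2 * D ^+ 2) by rewrite !mulr_ge0// ltW.
by nra.
Qed.

(* Comparing with [x] itself would only give the constant 1/2 in place of 1;
   the factor 2 gained here is what makes the steps almost decreasing. *)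
Lemma resolvent_energy_drop (tau : R) x x' : 0 < tau ->
  dom x -> resolvent phi tau x x' ->
  mdist x x' ^+ 2 / tau - L / 2 * mdist x x' ^+ 2 <= f x - f x'.
Proof.
move=> tau0 xd rx; have xd' := resolvent_dom _ _ _ xd rx.
set a := mdist x x'.
apply: (@ler_lim0 _ _ _ (a ^+ 2 / (2 * tau))) => s /andP[s0 s1].
(* This geodesic runs from [x'] back to [x], so d(x, z) is exactly (1 - s) d(x, x'). The first-order
   decrease of its square produces the term [a ^+ 2 / tau]. *)
have [|z [zd _ xz fz]] := geodesic_semiconvex x' x s xd' xd.
  by rewrite (ltW s0).
have := resolvent_fine_le _ _ _ _ xd zd rx.
rewrite (metric_sym x z) xz (metric_sym x' x) in fz *.
rewrite -/a in fz *; move=> h1.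
rewrite -(ler_pM2l s0).
have E : ((1 - s) * a) ^+ 2 / (2 * tau) = a ^+ 2 / (2 * tau) +
    s * (s * (a ^+ 2 / (2 * tau))) - s * (a ^+ 2 / tau).
  by field; rewrite gt_eqF.
rewrite E in h1.
have a0 : 0 <= a := mdist_ge0 _ _.
have : 0 <= s * s * (L / 2 * a ^+ 2) by rewrite !mulr_ge0// ltW.
by nra.
Qed.

(** The drop from [x'] to [x''] is bounded below by the energy drop of the second step and above by
    the slope bound of the first step tested at [x'']. Dividing by d(x', x'') gives the claim. *)
Lemma resolvent_step_decreasing (tau : R) x x' x'' : 0 < tau -> dom x ->
  resolvent phi tau x x' -> resolvent phi tau x' x'' ->
  (1 - L * tau) * mdist x' x'' <= mdist x x'.
Proof.
move=> tau0 xd rx rx'; have xd' := resolvent_dom _ _ _ xd rx.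
have xd'' := resolvent_dom _ _ _ xd' rx'.
have := resolvent_energy_drop _ _ _ tau0 xd' rx'.
have := resolvent_slope _ _ _ _ tau0 xd xd'' rx.
set a := mdist x x'; set b := mdist x' x'' => h1 h2.
have [->|b0] := eqVneq b 0; first by rewrite mulr0 mdist_ge0.
have {}b0 : 0 < b by rewrite lt_neqAle eq_sym b0 mdist_ge0.
have h := le_trans h2 h1.
rewrite -(ler_pM2r b0) -subr_ge0.
have -> : a * b - (1 - L * tau) * b * b =
  tau * (a / tau * b + L / 2 * b ^+ 2 - (b ^+ 2 / tau - L / 2 * b ^+ 2)).
  by field; rewrite gt_eqF.
by rewrite mulr_ge0 ?subr_ge0// ltW.
Qed.

(** * Iterated resolvents with constant step *)

Section scheme.
Variables (tau : R) (xs : nat -> X).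
Hypothesis tau_gt0 : 0 < tau.
Hypothesis xs0_dom : dom (xs 0%N).
Hypothesis xs_resolvent : forall k, resolvent phi tau (xs k) (xs k.+1).

Local Notation step k := (mdist (xs k) (xs k.+1)).

Lemma scheme_dom k : dom (xs k).
Proof. by elim: k => // k /resolvent_dom; apply. Qed.

Lemma scheme_energy k : f (xs k.+1) + step k ^+ 2 / (2 * tau) <= f (xs k).
Proof.
have := resolvent_fine_le _ _ _ _ (scheme_dom k) (scheme_dom k) (xs_resolvent k).
by rewrite mdistxx expr0n/= mul0r addr0.
Qed.

Lemma scheme_nonincreasing k : f (xs k) <= f (xs 0%N).
Proof.
elim: k => // k; apply: le_trans; apply: le_trans (scheme_energy k).
by rewrite lerDl divr_ge0 ?sqr_ge0// mulr_ge0// ltW.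
Qed.

Lemma scheme_step_decreasing i j : L * tau <= 1 ->
  (1 - L * tau) ^+ j * step (i + j) <= step i.
Proof.
move=> Ltau; elim: j => [|j IH]; first by rewrite expr0 mul1r addn0.
apply: le_trans IH; rewrite exprSr -mulrA ler_wpM2l ?exprn_ge0 ?subr_ge0//.
by rewrite addnS; apply: resolvent_step_decreasing => //; exact: scheme_dom.
Qed.

Lemma scheme_energy_drop m n c : 0 <= c ->
  (forall i, (i < n)%N -> c <= step (m + i)) ->
  n%:R * (c ^+ 2 / (2 * tau)) <= f (xs m) - f (xs (m + n)).
Proof.
move=> c0; elim: n => [|n IH] cstep; first by rewrite mul0r addn0 subrr.
have {IH} := IH (fun i ilt => cstep i (ltnW ilt)).
have := scheme_energy (m + n).
have : c ^+ 2 / (2 * tau) <= step (m + n) ^+ 2 / (2 * tau).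
  rewrite ler_wpM2r ?invr_ge0 ?mulr_ge0 ?(ltW tau_gt0)//.
  by rewrite ler_sqr ?nnegrE ?mdist_ge0// cstep.
by rewrite addnS -natr1 mulrDl mul1r; lra.
Qed.

(** By Bernoulli and L h <= 1/2, every step of the window is at least half the last step a. The drop
    of phi is therefore at least (N + 1) (a / 2)^2 / (2 tau), which equals (h / 8) (a / tau)^2. *)
Lemma scheme_speed_le m N (h : R) : tau = h / N.+1%:R -> L * h <= 1 / 2 ->
  (step (m + N) / tau) ^+ 2 <= 8 / h * (f (xs m) - f (xs (m + N.+1))).
Proof.
move=> tauE Lh; have N0 : 0 < N.+1%:R :> R by rewrite ltr0n.
have hE : h = N.+1%:R * tau by rewrite tauE mulrC divfK ?gt_eqF.
have h0 : 0 < h by rewrite hE mulr_gt0.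
have N1 : 1 <= N.+1%:R :> R by rewrite ler1n.
have Lt0 : 0 <= L * tau by rewrite mulr_ge0// ltW.
have NLt : N.+1%:R * (L * tau) <= 1 / 2.
  by rewrite (le_trans _ Lh)// hE mulrCA.
have Lt1 : L * tau <= 1 by rewrite hE in Lh; nra.
set a := step (m + N).
have a0 : 0 <= a := mdist_ge0 _ _.
have : N.+1%:R * ((a / 2) ^+ 2 / (2 * tau)) <= f (xs m) - f (xs (m + N.+1)).
  apply: scheme_energy_drop; first by rewrite divr_ge0.
  move=> i; rewrite ltnS => iN.
  apply: le_trans (scheme_step_decreasing (m + i) (N - i) Lt1).
  rewrite -addnA subnKC// -/a mulrC ler_wpM2r//.
  apply: le_trans (bernoulli_ge _ _ (N - i)%N _); last by rewrite Lt0.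
  have : (N - i)%:R * (L * tau) <= N.+1%:R * (L * tau).
    by rewrite ler_wpM2r// ler_nat (leq_trans (leq_subr _ _)).
  by lra.
rewrite -(ler_pM2l (_ : 0 < 8 / h)) ?divr_gt0//; apply: le_trans.
rewrite hE le_eqVlt; apply/orP; left; apply/eqP; field.
by rewrite !gt_eqF.
Qed.

End scheme.

(** * Local slope and lower semicontinuity *)

Lemma local_slope_le x (v : R) : dom x -> 0 <= v ->
  (forall y, dom y ->
    f x - f y <= v * mdist x y + L / 2 * mdist x y ^+ 2) ->
  (local_slope phi x <= v%:E)%E.
Proof.
move=> xd v0 slope_le; rewrite /local_slope ge_max lee_fin v0/=.
apply/lee_addgt0Pr => e e0; rewrite limf_esupE.
(* Within this radius the quadratic term, divided by the distance, is at most e. Using L + 1 avoids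
   a division by zero when L = 0. *)
pose r := e / (L + 1).
have L1 : 0 < L + 1 by rewrite ltr_wpDl.
have r0 : 0 < r by rewrite divr_gt0.
apply: le_trans (ereal_inf_lbound _) _.
  exists (ball x r `&` [set y | y != x]) => //=.
  by rewrite /dnbhs /within/=; near=> y => yx; split => //; near: y;
    exact: nbhsx_ballx.
apply: ub_ereal_sup => _ [y [+ yx] <-]; rewrite ballEmdist/= => xyr.
have D0 : 0 < mdist x y by rewrite mdist_gt0 eq_sym.
have [->|yd] := eqVneq (phi y) +oo%E.
  rewrite (finite_domain_fineK _ xd) (_ : maxe _ _ = 0%E) ?mul0e.
    by rewrite adde_ge0 ?lee_fin// ltW.
  by apply/max_idPr; rewrite leNye.
rewrite (finite_domain_fineK _ xd) (finite_domain_fineK _ yd).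
rewrite -EFinB -EFin_max -EFinM -EFinD lee_fin ler_pdivrMr// ge_max.
rewrite mulr_ge0 ?(addr_ge0, ltW e0, ltW D0)// andbT.
apply: le_trans (slope_le _ yd) _; rewrite mulrDl lerD2l expr2 mulrA.
rewrite ler_wpM2r ?(ltW D0)//.
have : (L + 1) * mdist x y <= e by rewrite mulrC -ler_pdivlMr// ltW.
by have := L_ge0; nra.
Unshelve. all: by end_near. Qed.

Lemma lower_semicontinuous_near x (c : R) : lower_semicontinuous phi ->
  dom x -> c < f x ->
  exists2 r : R, 0 < r & forall y, dom y -> mdist y x < r -> c < f y.
Proof.
move=> lsc xd cf; have [|V /nbhs_ballP[r/= r0 rV] Vc] := lsc x c.
  by rewrite (finite_domain_fineK _ xd) lte_fin.
exists r => // y yd yx; have := Vc y.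
rewrite (finite_domain_fineK _ yd) lte_fin; apply; apply: rV.
by rewrite ballEmdist/= metric_sym.
Qed.

End semiconvex.

(** * Discrete solutions on uniform partitions *)

Lemma interpolated_curveE {R : realType} {X : metricType R} (P : nat -> R)
    (xs : nat -> X) k (t : R) : (forall k, P k < P k.+1) ->
  P k < t <= P k.+1 -> interpolated_curve P xs t = xs k.+1.
Proof.
move=> Pinc /andP[kt tk]; congr xs.
have /increasing_seqP Pmono := Pinc.
apply: xget_unique; first by exists k => //; rewrite kt tk.
move=> _ [j -> /andP[jt tj]]; congr _.+1; apply/eqP; rewrite eqn_leq.
have := lt_le_trans kt tj; have := lt_le_trans jt tk.
by rewrite !ltNge !Pmono -!ltnNge !ltnS => -> ->.
Qed.

Section flow.
Context {R : realType} {X : metricType R}.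
Variables (phi : X -> \bar R) (taustar : \bar R).
Hypothesis phi_coercive : coercive phi taustar.

Lemma uniform_discrete_solution x0 (tau : R) : 0 < tau -> (tau%:E < taustar)%E ->
  exists xs : nat -> X,
    xs 0%N = x0 /\ forall k, resolvent phi tau (xs k) (xs k.+1).
Proof.
move=> tau0 taus.
have [J JP] : {J : X -> X & forall x, resolvent phi tau x (J x)}.
  apply: choice => x; have [_ /(_ x tau tau0 taus)[_ [z rz]]] := phi_coercive.
  by exists z.
by exists (fun k => iter k J x0); split => // k; exact: JP.
Qed.

(** A step dividing h makes the indices for t and t + h differ by exactly N + 1, although t need not
    be a node. The assumption h <= t leaves a full window of N + 1 steps before t as well, starting
    at index [p]. *)
Lemma discrete_limit_uniform x0 xi (t h eta : R) : 0 < h <= t -> 0 < eta ->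
  discrete_limit phi taustar x0 xi ->
  exists N (xs : nat -> X) p,
    let tau := h / N.+1%:R in
    [/\ xs 0%N = x0, forall k, resolvent phi tau (xs k) (xs k.+1),
      mdist (xs (p + N.+1)%N) (xi t) < eta &
      mdist (xs (p + N.+1 + N.+1)%N) (xi (t + h)) < eta].
Proof.
move=> /andP[h0 ht] eta0 /(_ (t + h) eta eta0)[delta delta0 lim].
have [taus0 _] := phi_coercive.
have [c [c0 cdelta ctau]] : exists c : R, [/\ 0 < c, c <= delta &
    (c%:E <= taustar)%E].
  case: taustar taus0 => [r| |]// r0; last by exists delta; rewrite leey.
  exists (Num.min delta r).
  by rewrite lt_min delta0 -lte_fin r0 lee_fin !ge_min !lexx orbT.
(* This makes the step h / (N + 1) smaller than c, hence admissible for both [delta] and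
   [taustar]. *)
pose N := Num.trunc (h / c).
have NE : h / c < N.+1%:R by exact: truncnS_gt.
exists N; set tau := h / N.+1%:R.
have N0 : 0 < N.+1%:R :> R by rewrite ltr0n.
have tau0 : 0 < tau by rewrite divr_gt0.
have hE : h = N.+1%:R * tau by rewrite mulrC divfK ?gt_eqF.
have tauc : tau < c by rewrite ltr_pdivrMr// mulrC -ltr_pdivrMr.
have taus : (tau%:E < taustar)%E by apply: lt_le_trans ctau; rewrite lte_fin.
have [xs [xs0 xsJ]] := uniform_discrete_solution x0 _ tau0 taus.
have exm : exists m, t <= m%:R * tau.
  exists (Num.trunc (t / tau)).+1.
  by rewrite -ler_pdivrMr// ltW// truncnS_gt.
(* The least such m satisfies (m - 1) tau < t <= m tau, so the interpolated curve takes the value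
   [xs m] at t. *)
case: (ex_minnP exm) => m tm mmin.
have Nm : (N.+1 <= m)%N.
  rewrite -(ler_nat R) -(ler_pM2r tau0) (le_trans _ tm)//.
  by rewrite -hE.
have m0 : (0 < m)%N := leq_trans (ltn0Sn N) Nm.
have mt : m.-1%:R * tau < t.
  by rewrite ltNge; apply/negP => /mmin; rewrite leqNgt prednK// leqnn.
pose P k : R := k%:R * tau.
have PS k : P k.+1 - P k = tau by rewrite /P -natr1 mulrDl mul1r addrC addKr.
have Pinc k : P k < P k.+1 by rewrite -subr_gt0 PS.
have Ppart : partition_of_halfline P.
  split => //; first by rewrite /P mul0r.
  apply/cvgryPge => A; near=> k.
  rewrite /P -ler_pdivrMr//; near: k; exact: nbhs_infty_ger.
have meshP : (mesh P <= tau%:E)%E.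
  by apply: ub_ereal_sup => _ [k _ <-]; rewrite PS.
have sol : discrete_solution phi P x0 xs by split => // k; rewrite PS.
have {}lim s : 0 <= s <= t + h -> mdist (interpolated_curve P xs s) (xi s) < eta.
  apply: lim => //; first exact: le_lt_trans taus.
  by apply: le_lt_trans meshP _; rewrite lte_fin (lt_le_trans tauc).
have t0 : 0 < t := lt_le_trans h0 ht.
exists xs, (m - N.+1)%N; split => //; rewrite subnK//.
  rewrite -{1}(prednK m0) -(interpolated_curveE P xs m.-1 t Pinc).
    by apply: lim; rewrite (ltW t0) lerDl ltW.
  by rewrite prednK// mt.
have -> : (m + N.+1 = (m.-1 + N.+1).+1)%N by rewrite -addSn prednK.
rewrite -(interpolated_curveE P xs (m.-1 + N.+1) (t + h) Pinc).
  by apply: lim; rewrite lexx andbT addr_ge0// ltW.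
by rewrite -addSn prednK// /P !natrD !mulrDl -hE ltrD2r mt lerD2r.
Unshelve. all: by end_near. Qed.

End flow.

(** * Passing to the limit along the flow *)

Section flow_slope.
Context {R : realType} {X : metricType R}.
Variables (phi : X -> \bar R) (Gamma : set (R -> X)) (L : R).
Variables (taustar : \bar R) (x0 : X) (xi : R -> X) (h : R).
Hypothesis phi_gtNy : forall x, (-oo < phi x)%E.
Hypothesis phi_lsc : lower_semicontinuous phi.
Hypothesis Gamma_geodesics : geodesic_family Gamma.
Hypothesis L_ge0 : 0 <= L.
Hypothesis phi_convex : convex_along Gamma (- L) phi.
Hypothesis phi_coercive : coercive phi taustar.
Hypothesis x0_dom : finite_domain phi x0.
Hypothesis xi_dom : forall t : R, 0 <= t -> finite_domain phi (xi t).
Hypothesis xi_lim : discrete_limit phi taustar x0 xi.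
Hypothesis h_gt0 : 0 < h.
Hypothesis Lh_le : L * h <= 1 / 2.

Local Notation dom := (finite_domain phi).
Local Notation f x := (fine (phi x)).

(** If phi were larger at [xi t] than at [x0], lower semicontinuity would make it larger at nearby
    scheme points too, but phi does not increase along the scheme. *)
Lemma flow_le_init t : h <= t -> f (xi t) <= f x0.
Proof.
move=> ht; have xd : dom (xi t) by apply: xi_dom; rewrite (le_trans _ ht)// ltW.
rewrite leNgt; apply/negP => /(lower_semicontinuous_near _ phi_gtNy _ _ phi_lsc xd).
move=> [r r0 rP]; have ht' : 0 < h <= t by rewrite h_gt0.
have [N [xs [p [xs0 xsJ + _]]]] :=
  discrete_limit_uniform _ _ phi_coercive _ _ _ _ _ ht' r0 xi_lim.
have tau0 : 0 < h / N.+1%:R by rewrite divr_gt0// ltr0n.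
have xs0d : dom (xs 0%N) by rewrite xs0.
move=> /rP-/(_ (scheme_dom _ phi_gtNy _ _ xs0d xsJ _)).
by rewrite ltNge -xs0 (scheme_nonincreasing _ phi_gtNy _ _ tau0 xs0d xsJ).
Qed.

(** The slope bound is transferred from a scheme point [z'] near [xi (t + h)], whose speed is
    controlled by the drop from a scheme point [z] near [xi t]. The strict inequality on [v ^+ 2]
    leaves room for the approximation errors. *)
Lemma flow_slope t y (v : R) : h <= t -> dom y -> 0 <= v ->
  8 / h * (f (xi t) - f (xi (t + h))) < v ^+ 2 ->
  f (xi (t + h)) - f y <=
    v * mdist (xi (t + h)) y + L / 2 * mdist (xi (t + h)) y ^+ 2.
Proof.
move=> ht yd v0 gap.
have t0 : 0 <= t by rewrite (le_trans _ ht)// ltW.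
have h8 : 0 < 8 / h by rewrite divr_gt0.
set x := xi t in gap *; set x' := xi (t + h) in gap *.
have xd : dom x by exact: xi_dom.
have xd' : dom x' by apply: xi_dom; rewrite addr_ge0// ltW.
(* V will bound the speed at [z]. The inner 1 is the slack allowed in lower semicontinuity at
   [xi t]; the outer one gives v1 <= V from v1^2 <= V - 1 without a square root. *)
pose V := 8 / h * (f x0 - f x + 1) + 1.
have fx0 : f x <= f x0 by exact: flow_le_init.
have V0 : 0 < V by rewrite ltr_wpDl// mulr_ge0 ?(ltW h8)// addr_ge0// subr_ge0.
pose g := v ^+ 2 - 8 / h * (f x - f x').
have g0 : 0 < g by rewrite subr_gt0.
set D := mdist x' y; have D0 : 0 <= D := mdist_ge0 _ _.
(* C is the coefficient of [eta] in the final error, with eta^2 bounded by [eta]. *)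
pose C := v + L / 2 * (2 * D + 1) + 1.
apply: (@ler_lim0 _ _ _ C) => s /andP[s0 s1].
(* [eta * W] will be the error in the bound on the squared speed at [z']; it must fit into the gap
   [g]. *)
pose W := 8 / h * (V + L / 2 + 1).
have W0 : 0 < W by rewrite mulr_gt0// ltr_wpDl// addr_ge0 ?divr_ge0// ltW.
have [eta [eta0 etas etaW]] : exists eta : R,
    [/\ 0 < eta, eta <= s & eta * W <= g].
  exists (Num.min s (g / W)).
  by rewrite lt_min s0 divr_gt0// -ler_pdivlMr// !ge_min !lexx orbT.
have fx1 : f x - 1 < f x by rewrite ltrBlDr ltrDl.
have fx'1 : f x' - eta < f x' by rewrite ltrBlDr ltrDl.
have [r1 r10 r1P] := lower_semicontinuous_near _ phi_gtNy _ _ phi_lsc xd fx1.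
have [r2 r20 r2P] := lower_semicontinuous_near _ phi_gtNy _ _ phi_lsc xd' fx'1.
have e0 : 0 < Num.min eta (Num.min r1 r2) by rewrite !lt_min eta0 r10 r20.
have ht' : 0 < h <= t by rewrite h_gt0.
have [N [xs [p [xs0 xsJ]]]] :=
  discrete_limit_uniform _ _ phi_coercive _ _ _ _ _ ht' e0 xi_lim.
set tau := h / N.+1%:R in xsJ *.
rewrite !lt_min -/x -/x' => /and3P[zx zr1 _] /and3P[zx' _ zr2].
have tau0 : 0 < tau by rewrite divr_gt0// ltr0n.
have xs0d : dom (xs 0%N) by rewrite xs0.
have xsd := scheme_dom _ phi_gtNy _ _ xs0d xsJ.
have speed m := scheme_speed_le _ _ _ phi_gtNy Gamma_geodesics L_ge0 phi_convex
  _ _ tau0 xs0d xsJ m N h erefl Lh_le.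
have slope k w (wd : dom w) := resolvent_slope _ _ _ phi_gtNy Gamma_geodesics
  L_ge0 phi_convex _ _ _ _ tau0 (xsd k) wd (xsJ k).
have speed1 := speed p; have speed2 := speed (p + N.+1)%N.
have slope1 := slope (p + N)%N x xd; have slope2 := slope (p + N.+1 + N)%N y yd.
rewrite -!addnS in slope1 slope2.
rewrite !addnS in speed1 speed2 slope1 slope2 zx zr1 zx' zr2.
set z := xs (p + N).+1 in zx zr1 speed1 speed2 slope1 slope2.
set z' := xs ((p + N).+1 + N).+1 in zx' zr2 speed2 slope2.
have zd : dom z by exact: xsd.
have zd' : dom z' by exact: xsd.
set v1 := _ / tau in speed1 slope1; set v2 := _ / tau in speed2 slope2.
have v10 : 0 <= v1 by rewrite divr_ge0 ?mdist_ge0// ltW.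
have v20 : 0 <= v2 by rewrite divr_ge0 ?mdist_ge0// ltW.
have eta1 : eta <= 1 := le_trans etas s1.
have v1V : v1 <= V.
  have V1 : v1 ^+ 2 <= V - 1.
    apply: le_trans speed1 _; rewrite /V addrK ler_pM2l//.
    have : f (xs p) <= f x0.
      by rewrite -xs0; exact: (scheme_nonincreasing _ phi_gtNy _ _ tau0 xs0d xsJ).
    by have := r1P _ zd zr1; lra.
  by nra.
(* Lower semicontinuity gives no upper bound on phi at [z]. It comes from the slope bound at [z]
   tested at [xi t], where the speed is at most V thanks to the window before t. *)
have fz : f z <= f x + eta * (V + L / 2).
  have d0 : 0 <= mdist z x := mdist_ge0 _ _.
  have h1 : v1 * mdist z x <= V * eta by rewrite ler_pM// ltW.
  have h2 : L / 2 * mdist z x ^+ 2 <= L / 2 * eta.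
    rewrite ler_wpM2l ?divr_ge0// expr2 -[leRHS]mul1r ler_pM// ?ltW//.
    exact: lt_le_trans eta1.
  by lra.
have fz' := r2P _ zd' zr2.
have v2v : v2 <= v.
  rewrite -ler_sqr ?nnegrE// (le_trans speed2)//.
  apply: le_trans (_ : 8 / h * (f x - f x' + eta * (V + L / 2 + 1)) <= _).
    by rewrite ler_pM2l//; lra.
  by move: etaW; rewrite /g /W; lra.
have d20 : 0 <= mdist z' y := mdist_ge0 _ _.
have d2 : mdist z' y <= D + eta.
  by rewrite addrC (le_trans (metric_triangle _ x' _))// lerD2r ltW.
have h1 : v2 * mdist z' y <= v * (D + eta) by rewrite ler_pM.
have h2 : L / 2 * mdist z' y ^+ 2 <= L / 2 * (D + eta) ^+ 2.
  by rewrite ler_wpM2l ?divr_ge0// ler_sqr ?nnegrE// addr_ge0// ltW.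
have h3 : L / 2 * (D + eta) ^+ 2 <= L / 2 * (D ^+ 2 + eta * (2 * D + 1)).
  by rewrite ler_wpM2l ?divr_ge0//; nra.
have h4 : eta * C <= s * C.
  by rewrite ler_wpM2r// /C !addr_ge0// mulr_ge0 ?divr_ge0// addr_ge0// mulr_ge0.
by move: h4; rewrite /C; lra.
Qed.

End flow_slope.

(** * Long-time limit of the slope *)

Theorem theorem4p12 (R : realType) (X : completeMetricType R)
    (phi : X -> \bar R) (Gamma : set (R -> X)) (lambda K : R)
    (taustar : \bar R) (G : R -> X -> X) (x0 : X) (l : \bar R)
    (phi_gtNy : forall x, (-oo < phi x)%E)
    (phi_lsc : lower_semicontinuous phi)
    (phi_proper : finite_domain phi !=set0)
    (Gamma_geodesics : geodesic_family Gamma)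
    (phi_convex : convex_along Gamma lambda phi)
    (sqdist_convex : sqdist_convex_along Gamma K)
    (Gamma_commutativity : commutativity Gamma)
    (phi_coercive : coercive phi taustar)
    (G_flow : gradient_flow_operator phi taustar G)
    (x0_dom : finite_domain phi x0)
    (phi_lim : phi (G t x0) @[t --> +oo] --> l)
    (l_gtNy : (-oo < l)%E) :
  local_slope phi (G t x0) @[t --> +oo] --> 0%E.
Proof.
have [xi_dom xi_lim] := G_flow _ x0_dom.
set xi := G ^~ x0 in xi_dom xi_lim; set f := fun x => fine (phi x).
(* -L <= lambda weakens the convexity assumption, and L > 0 allows the window length h = 1 / (2
   L). *)
pose L := `|lambda| + 1.
have L0 : 0 < L by rewrite ltr_wpDl.
have L_ge0 := ltW L0.
have convL : convex_along Gamma (- L) phi.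
  move=> g Gg g0 g1 t t01; apply: le_trans (phi_convex g Gg g0 g1 t t01) _.
  rewrite leeD2l// leeN2 lee_fin ler_wpM2r ?sqr_ge0// ler_wpM2r//.
    by case/andP: t01.
  rewrite ler_wpM2r ?subr_ge0//; first by case/andP: t01.
  rewrite ler_pM2r ?invr_gt0//.
  have : - `|lambda| <= lambda by rewrite lerNl -normrN ler_norm.
  by rewrite /L; lra.
pose h := (2 * L)^-1.
have h0 : 0 < h by rewrite invr_gt0 mulr_gt0.
have Lh : L * h <= 1 / 2.
  by rewrite /h invfM mulrCA mulfV ?gt_eqF// mulr1 div1r.
have fcvg : f (xi t) @[t --> +oo] --> fine l.
  have : (phi (xi t) @[t --> +oo] --> (fine l)%:E).
    rewrite fineK// fin_numE -ltNye l_gtNy/= -ltey.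
    (* The bound by phi(x0) excludes l = +oo, so that [fine l] is the actual limit. *)
    have : (l <= (f x0)%:E)%E.
      apply: cvge_le phi_lim; near=> t.
      have ht : h <= t by by near: t; apply: nbhs_pinfty_ge; rewrite num_real.
      have td : finite_domain phi (xi t).
        by apply: xi_dom; rewrite (le_trans _ ht)// ltW.
      rewrite (finite_domain_fineK _ phi_gtNy _ td) lee_fin.
      exact: (flow_le_init phi taustar x0 xi h).
    by move=> /le_lt_trans; apply; rewrite ltry.
  by move=> /fine_cvgP[].
have gap_cvg : 8 / h * (f (xi (t - h)) - f (xi t)) @[t --> +oo] --> 0.
  rewrite -(mulr0 (8 / h)) -(subrr (fine l)).
  apply: cvgM; first exact: cvg_cst.
  apply: cvgB => //; apply: cvg_comp fcvg; exact: cvg_addrr.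
have slope_le (e : R) : 0 < e ->
    \forall t \near +oo, (local_slope phi (xi t) <= e%:E)%E.
  move=> e0; near=> t.
  have ht : h <= t - h.
    rewrite lerBrDr; by near: t; apply: nbhs_pinfty_ge; rewrite num_real.
  have td : finite_domain phi (xi t).
    by apply: xi_dom; rewrite (le_trans (ltW h0))// (le_trans ht)// gerBl ltW.
  apply: (local_slope_le phi L) => //; first exact: ltW.
  (* The slope at t is estimated with the window starting at t - h. *)
  move=> y yd; rewrite -[t](subrK h).
  apply: (flow_slope phi Gamma L taustar x0 xi h) => //; first exact: ltW.
  rewrite subrK; near: t; apply: (cvgr_lt 0) => //.
  by rewrite exprn_gt0.
have slope_ge0 x : (0 <= local_slope phi x)%E by rewrite le_max lexx.
apply/fine_cvgP; split.
  near=> t; rewrite ge0_fin_numE//.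
  have /le_lt_trans : (local_slope phi (xi t) <= 1%:E)%E.
    by near: t; exact: slope_le.
  by apply; rewrite ltry.
apply/cvgrPdist_le => e e0; near=> t.
rewrite /= sub0r normrN ger0_norm ?fine_ge0//.
have slope_e : (local_slope phi (xi t) <= e%:E)%E by near: t; exact: slope_le.
rewrite -lee_fin fineK// ge0_fin_numE//.
by apply: le_lt_trans slope_e _; rewrite ltry.
Unshelve. all: by end_near. Qed.
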